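(* Let $f=\sigma_m\circ H_m\circ\cdots\circ\sigma_1\circ H_1$ be a standard composition defined on an interval $(a,b)$, and suppose that each map $H_i$ can be written as a composition $H_i=h_i\circ g_i$, where $h_i$ is a linear-fractional map. Put $$\tilde D=\sum_{j=1}^m\|\mathcal{P}(g_j)-\mathrm{id}\|_{C^0},\qquad \Delta=\max\left\{\left|\sum_{i=1}^{j}(\mathcal{P}(h_i)-\mathrm{id})\right|:1\le j\le m\right\},\qquad S_m=\mathcal{P}(\sigma_m)\circ\cdots\circ\mathcal{P}(\sigma_1).$$ Then $$\|\mathcal{P}(f)-S_m\|_{C^0}\le\tilde D+2\Delta .$$
   Context: Cross-ratio: $Cr(\alpha,\beta,\gamma,\delta)=\frac{(\beta-\alpha)(\delta-\gamma)}{(\gamma-\alpha)(\delta-\beta)}$. For a bounded interval $I=(\alpha,\delta)$, $\mathcal{P}_{I}(\gamma)=-\log Cr(\alpha,\frac{\alpha+\delta}{2},\gamma,\delta)$ maps $I$ onto $\mathbb{R}$. For an orientation-preserving homeomorphism $\phi$ from an interval $I$ onto an interval $J$, $\mathcal{P}(\phi)=\mathcal{P}_{J}\circ\phi\circ\mathcal{P}_{I}^{-1}:\mathbb{R}\to\mathbb{R}$, and $\mathcal{D}(\phi)=\|\mathcal{P}(\phi)-\mathrm{id}\|_{C^0}$ (sup norm over $\mathbb{R}$). Standard composition on $(a,b)$: a function $f=\sigma_m\circ H_m\circ\cdots\circ\sigma_1\circ H_1$ on $(a,b)$, where all maps $H_i,\sigma_i$ are defined on intervals and are order-preserving homeomorphisms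 onto the domain of the next map, each $\sigma_i$ has non-negative Schwarzian derivative, and $\max_i\mathcal{D}(H_i)\le\log 2$. In $H_i=h_i\circ g_i$, the map $g_i$ is an order-preserving homeomorphism from the domain of $H_i$ onto the domain of $h_i$, and $h_i$ is an order-preserving linear-fractional homeomorphism between intervals. For such linear-fractional $h_i$, $\mathcal{P}(h_i)$ is a translation of $\mathbb{R}$, so $\mathcal{P}(h_i)-\mathrm{id}$ is a constant. *)

(* Defs.v *)
From HB Require Import structures.
From mathcomp Require Import all_boot all_order all_algebra.
From mathcomp Require Import all_classical all_reals all_analysis.
Set Implicit Arguments.
Unset Strict Implicit.
Unset Printing Implicit Defensive.
Import Order.TTheory GRing.Theory Num.Theory.
Import numFieldNormedType.Exports.
Local Open Scope classical_set_scope.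
Local Open Scope ring_scope.

(* A bounded open interval is given by its pair of endpoints.  A map between
   intervals is a total function R -> R of which only the values on the domain
   interval matter. *)
Definition oitv (R : realType) (I : R * R) : set R := `]I.1, I.2[.

Definition Cr (R : realType) (alpha beta gamma delta : R) : R :=
  ((beta - alpha) * (delta - gamma)) / ((gamma - alpha) * (delta - beta)).

Definition proj_coord (R : realType) (I : R * R) (gamma : R) : R :=
  - ln (Cr I.1 ((I.1 + I.2) / 2) gamma I.2).

(* P_J \o phi \o P_I^-1; [pinv (oitv I)] is the inverse on R of the restriction
   of the coordinate P_I to I. *)
Definition proj_map (R : realType) (I J : R * R) (phi : R -> R) : R -> R :=
  proj_coord J \o phi \o pinv (oitv I) (proj_coord I).

(* Extended-real valued, so that an unbounded function has norm +oo. *)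
Definition C0norm (R : realType) (u : R -> R) : \bar R :=
  ereal_sup [set `|u x|%:E | x in [set: R]].

Definition dist_id (R : realType) (I J : R * R) (phi : R -> R) : \bar R :=
  C0norm (fun x => proj_map I J phi x - x).

Record order_homeo (R : realType) (I J : R * R) (phi : R -> R) : Prop := {
  oh_bij : set_bij (oitv I) (oitv J) phi ;
  oh_cont : {within oitv I, continuous phi} ;
  oh_inv_cont : {within oitv J, continuous (pinv (oitv I) phi)} ;
  oh_incr : {in oitv I &, {homo phi : x y / x < y}}
}.

Definition schwarzian (R : realType) (s : R -> R) (x : R) : R :=
  derive1n 3 s x / derive1n 1 s x
  - 3 / 2 * (derive1n 2 s x / derive1n 1 s x) ^+ 2.

(* [derive1n] is total: three derivatives and s' <> 0 are what is needed for
   the Schwarzian derivative to make sense on I. *)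
Definition nonneg_schwarzian (R : realType) (I : R * R) (s : R -> R) : Prop :=
  forall x, x \in oitv I ->
    [/\ forall k, (k < 3)%N -> derivable (derive1n k s) x 1,
        derive1n 1 s x != 0 &
        0 <= schwarzian s x].

Definition linear_fractional (R : realType) (I : R * R) (h : R -> R) : Prop :=
  exists A B C D : R, A * D - B * C != 0 /\
    forall x, x \in oitv I ->
      C * x + D != 0 /\ h x = (A * x + B) / (C * x + D).

(* comp_upto F n = F n \o ... \o F 1 *)
Fixpoint comp_upto (T : Type) (F : nat -> T -> T) (n : nat) : T -> T :=
  if n is k.+1 then F k.+1 \o comp_upto F k else id.

(* f = sigma_m \o H_m \o ... \o sigma_1 \o H_1 on (a, b), where
   H_i : U_(i-1) -> V_i and sigma_i : V_i -> U_i, with U_0 = (a, b).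
   The values of the families outside the index range 1..m
   (0..m for U) are irrelevant. *)
Record standard_composition (R : realType) (m : nat) (a b : R) (f : R -> R)
    (U V : nat -> R * R) (H sigma : nat -> R -> R) : Prop := {
  sc_m_gt0 : (0 < m)%N ;
  sc_ltab : a < b ;
  sc_dom : U 0%N = (a, b) ;
  sc_H : forall i, (1 <= i <= m)%N -> order_homeo (U i.-1) (V i) (H i) ;
  sc_sigma : forall i, (1 <= i <= m)%N -> order_homeo (V i) (U i) (sigma i) ;
  sc_schwarz : forall i, (1 <= i <= m)%N -> nonneg_schwarzian (V i) (sigma i) ;
  sc_dist : forall i, (1 <= i <= m)%N ->
    (dist_id (U i.-1) (V i) (H i) <= (ln 2)%:E)%E ;
  sc_comp : {in oitv (a, b), f =1 comp_upto (fun i => sigma i \o H i) m}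
}.

(* h_i goes from W_i to V_i. *)
Definition Dtilde (R : realType) (m : nat) (U W : nat -> R * R)
    (g : nat -> R -> R) : \bar R :=
  (\sum_(1 <= j < m.+1) dist_id (U j.-1) (W j) (g j))%E.

(* Each P(h_i) - id is a constant function when h_i is linear-fractional, so
   the C^0 norm below is the absolute value of the sum of these constants. *)
Definition Delta (R : realType) (m : nat) (W V : nat -> R * R)
    (h : nat -> R -> R) : \bar R :=
  \big[maxe/-oo%E]_(1 <= j < m.+1)
    C0norm (fun x => \sum_(1 <= i < j.+1) (proj_map (W i) (V i) (h i) x - x)).

Definition sigma_comp (R : realType) (m : nat) (V U : nat -> R * R)
    (sigma : nat -> R -> R) : R -> R :=
  comp_upto (fun i => proj_map (V i) (U i) (sigma i)) m.

(* Main.v *)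
Require Import Defs.
From HB Require Import structures.
From mathcomp Require Import all_boot all_order all_algebra.
From mathcomp Require Import all_classical all_reals all_analysis.
From mathcomp Require Import ring lra.
Set Implicit Arguments.
Unset Strict Implicit.
Import Order.TTheory GRing.Theory Num.Theory.
Import numFieldNormedType.Exports.
Local Open Scope classical_set_scope.
Local Open Scope ring_scope.

(** In the coordinates P_I every map becomes a map of the real line, and
    |P_I x - P_I y| is the logarithm of a cross-ratio, i.e. the Hilbert
    distance of I.  Two facts about this metric carry the proof.

    A map with non-negative Schwarzian derivative does not expand it, so each
    P(sigma_i) is nondecreasing and 1-Lipschitz
    ([proj_map_nonneg_schwarzian]).  Indeed phi = s'^(-1/2) satisfies
    phi'' = - (S s / 2) phi, hence is concave and lies below each of its
    tangent lines.  The linear-fractional map M that agrees with s to second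
    order at x has M'^(-1/2) equal to the tangent line of phi at x, so
    s' >= M', and s moves points away from s x at least as far as M does
    ([schwarzian_chord]).  Letting the point tend to the endpoints compares the
    Hilbert densities at s x of the image of s and of the image of M; the
    latter is the one that makes M an isometry ([coord_contraction]).

    A linear-fractional map preserves cross-ratios, so P(h_i) is a translation
    by some c_i ([proj_map_linear_fractional]).

    What remains concerns real numbers ([perturbed_contractions]).  Follow the
    orbits u_j and v_j of one point under P(f) and S_m.  At step j the
    difference d = u - v is first increased by c_j up to an error
    e_j <= |P(g_j) - id|, and then P(sigma_j) replaces it by some number between
    0 and itself.  With partial sums s_j of the c_i, all bounded by Delta in
    absolute value, |d_j - s_j| <= Delta + e_1 + ... + e_j is preserved: moving
    d_j to 0 can only bring it to distance |s_j| <= Delta from s_j.  At j = m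
    this gives |d_m| <= 2 Delta + sum of the e_j. *)

(** * Consequences of the mean value theorem *)
Lemma in_oitv (R : realType) (I : R * R) (x : R) :
  (x \in oitv I) = (I.1 < x < I.2).
Proof. by apply/idP/idP; rewrite inE /oitv /= in_itv. Qed.

Lemma MVT_oo (R : realType) (a b : R) (f df : R -> R) :
  (forall x, a < x < b -> is_derive x 1 f (df x)) ->
  forall x y, a < x < b -> a < y < b -> x <= y ->
  exists2 c, x <= c <= y & f y - f x = df c * (y - x).
Proof.
move=> Hd x y /andP[ax xb] /andP[ay yb] xy.
have inab z : z \in `[x, y]%R -> a < z < b.
  rewrite in_itv /= => /andP[xz zy].
  by rewrite (lt_le_trans ax xz) (le_lt_trans zy yb).
have [||c cxy E] := @MVT_segment R f df x y xy.
- move=> z zxy; apply: Hd; apply: inab.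
  by apply: subset_itv_oo_cc.
- apply: continuous_in_subspaceT => z; rewrite inE /= => /inab zab.
  have [dz _] := Hd _ zab.
  exact/differentiable_continuous/derivable1_diffP.
- by exists c => //; move: cxy; rewrite in_itv.
Qed.

Lemma ge0_derive_le (R : realType) (a b : R) (f df : R -> R) :
  (forall x, a < x < b -> is_derive x 1 f (df x)) ->
  (forall x, a < x < b -> 0 <= df x) ->
  forall x y, a < x < b -> a < y < b -> x <= y -> f x <= f y.
Proof.
move=> Hd Hge x y xab yab xy.
have [c /andP[xc cy] E] := MVT_oo Hd xab yab xy.
rewrite -subr_ge0 E mulr_ge0 ?subr_ge0 ?Hge //.
case/andP: xab => ax _; case/andP: yab => _ yb.
by rewrite (lt_le_trans ax xc) (le_lt_trans cy yb).
Qed.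

Lemma concave_le_tangent (R : realType) (a b : R) (f df d2f : R -> R) :
  (forall x, a < x < b -> is_derive x 1 f (df x)) ->
  (forall x, a < x < b -> is_derive x 1 df (d2f x)) ->
  (forall x, a < x < b -> d2f x <= 0) ->
  forall x t, a < x < b -> a < t < b -> f t <= f x + df x * (t - x).
Proof.
move=> Hd Hd2 Hle x t xab tab.
have anti y z : a < y < b -> a < z < b -> y <= z -> df z <= df y.
  move=> yab zab yz; rewrite -lerN2.
  apply: (@ge0_derive_le _ a b (fun u => - df u) (fun u => - d2f u)) => //.
  - by move=> u /Hd2 du; apply: is_deriveN.
  - by move=> u /Hle; rewrite oppr_ge0.
have inab y z c : a < y < b -> a < z < b -> y <= c <= z -> a < c < b.
  move=> /andP[ay _] /andP[_ zb] /andP[yc cz].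
  by rewrite (lt_le_trans ay yc) (le_lt_trans cz zb).
have [xt|/ltW tx] := leP x t.
- have [c cxt E] := MVT_oo Hd xab tab xt.
  have cab := inab _ _ _ xab tab cxt.
  rewrite -lerBlDl E ler_wpM2r ?subr_ge0 // anti //.
  by case/andP: cxt.
- have [c cxt E] := MVT_oo Hd tab xab tx.
  have cab := inab _ _ _ tab xab cxt.
  have h : df x * (x - t) <= f x - f t.
    rewrite E ler_wpM2r ?subr_ge0 // anti //.
    by case/andP: cxt.
  lra.
Qed.

(** * Maps with non-negative Schwarzian derivative *)

(** For varying q, these are the linear-fractional maps that vanish at x and have
    derivative p there; their second derivative at x is 2 p q. *)
Lemma derive_shift_div (R : realType) (x p q t : R) : 1 - q * (t - x) != 0 ->
  is_derive t 1 (fun z : R => p * (z - x) / (1 - q * (z - x)))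
    (p / (1 - q * (t - x)) ^+ 2).
Proof.
move=> nz.
have d1 : is_derive t 1 (fun z : R => 1 - q * (z - x)) (- q).
  by apply: is_derive_eq; rewrite /GRing.scale /=; ring.
have d2 : is_derive t 1 (fun z : R => p * (z - x)) p.
  by apply: is_derive_eq; rewrite /GRing.scale /=; ring.
have d3 := @is_deriveV R (fun z : R => 1 - q * (z - x)) _ _ _ nz d1.
have d4 := is_deriveM d2 d3.
apply: (@is_derive_eq _ _ _ _ _ _ _ _ d4).
by rewrite /GRing.scale /=; field.
Qed.

(** Here ds is s' and n is s'' / (2 s').  The linear-fractional map
    M t = s x + ds x (t - x) / (1 - n x (t - x)) has the same value, first and
    second derivative as s at x.  The conclusion says that its pole is outside I
    and that s t - M t has the sign of t - x; denominators are cleared so that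
    the inequality is affine in t and in s t separately, which lets t tend to
    an endpoint of I. *)
Lemma schwarzian_chord (R : realType) (I : R * R) (s : R -> R) :
  {in oitv I &, {homo s : x y / x < y}} -> nonneg_schwarzian I s ->
  exists ds n : R -> R,
    [/\ forall x, I.1 < x < I.2 -> is_derive x 1 s (ds x),
        forall x, I.1 < x < I.2 -> 0 < ds x &
        forall x t, I.1 < x < I.2 -> I.1 < t < I.2 ->
          0 < 1 - n x * (t - x) /\
          0 <= (t - x) * ((s t - s x) * (1 - n x * (t - x)) - ds x * (t - x))].
Proof.
move=> incs Hs.
pose d1 := derive1n 1 s; pose d2 := derive1n 2 s; pose d3 := derive1n 3 s.
have Hder k x : (k < 3)%N -> I.1 < x < I.2 ->
    is_derive x 1 (derive1n k s) (derive1n k.+1 s x).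
  move=> k3; rewrite -in_oitv => /Hs[D _ _].
  by apply: DeriveDef; [exact: D | rewrite derive1nS derive1E].
have D0 x : I.1 < x < I.2 -> is_derive x 1 s (d1 x) by exact: (Hder 0%N).
have D1 x : I.1 < x < I.2 -> is_derive x 1 d1 (d2 x) by exact: (Hder 1%N).
have D2 x : I.1 < x < I.2 -> is_derive x 1 d2 (d3 x) by exact: (Hder 2%N).
have d1_gt0 x : I.1 < x < I.2 -> 0 < d1 x.
  move=> xI; rewrite lt_neqAle eq_sym.
  have [_ -> _] := Hs _ (etrans (in_oitv _ _) xI).
  rewrite /= /d1 derive1n1.
  apply: (@incr_derive1_ge0_itv R s false true I.1 I.2) => //.
  - by move=> y; rewrite inE /= => /D0[].
  - by move=> y z yI zI; apply: incs; rewrite in_oitv.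
pose n x := d2 x / (2 * d1 x).
(* phi is s' to the power -1/2. *)
pose phi x := expR (- (ln (d1 x) / 2)).
have phi2 x : I.1 < x < I.2 -> phi x ^+ 2 = (d1 x)^-1.
  move=> /d1_gt0 d1x; rewrite /phi -expRM_natl.
  have -> : 2%:R * - (ln (d1 x) / 2) = - ln (d1 x) by field.
  by rewrite expRN lnK.
have Dphi x : I.1 < x < I.2 -> is_derive x 1 phi (- n x * phi x).
  move=> xI; have d1x := d1_gt0 _ xI.
  have L1 := is_derive1_comp (is_derive1_ln d1x) (D1 _ xI).
  have L2 : is_derive x 1 (fun y => - (ln (d1 y) / 2)) (- n x).
    have L := is_deriveN (is_deriveZ (2^-1) L1).
    have -> : (fun y => - (ln (d1 y) / 2)) = - (2^-1 \*: (@ln R \o d1)).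
      by apply/funext => y; rewrite /= mulrC.
    apply: (@is_derive_eq _ _ _ _ _ _ _ _ L).
    rewrite /GRing.scale /= /n; field.
    by rewrite (gt_eqF d1x).
  have L3 := is_derive1_comp (is_derive_expR _) L2.
  apply: (@is_derive_eq _ _ _ _ _ _ _ _ L3).
  by rewrite mulrC.
have Dn x : I.1 < x < I.2 ->
    is_derive x 1 n (schwarzian s x / 2 + n x ^+ 2).
  move=> xI; have d1x := lt0r_neq0 (d1_gt0 _ xI).
  have L1 : is_derive x 1 (fun y => 2 * d1 y) (2 * d2 x).
    have L := D1 _ xI.
    by apply: is_derive_eq; rewrite /GRing.scale /=; ring.
  have nz : 2 * d1 x != 0 by rewrite mulf_neq0.
  have LV := @is_deriveV R (fun y => 2 * d1 y) _ _ _ nz L1.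
  have L2 := is_deriveM (D2 _ xI) LV.
  apply: (@is_derive_eq _ _ _ _ _ _ _ _ L2).
  rewrite /GRing.scale /= /n /schwarzian -/d1 -/d2 -/d3.
  by field.
(* phi'' = - (S s / 2) phi, which is where the sign of S s enters. *)
have D2phi x : I.1 < x < I.2 ->
    is_derive x 1 (fun y => - n y * phi y) (- (schwarzian s x / 2) * phi x).
  move=> xI.
  have L := is_deriveM (is_deriveN (Dn _ xI)) (Dphi _ xI).
  apply: (@is_derive_eq _ _ _ _ _ _ _ _ L).
  by rewrite /GRing.scale /= opprfctE; ring.
have phi_gt0 x : 0 < phi x by exact: expR_gt0.
have tangent x t : I.1 < x < I.2 -> I.1 < t < I.2 ->
    phi t <= phi x * (1 - n x * (t - x)).
  move=> xI tI.
  have := concave_le_tangent Dphi D2phi _ xI tI.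
  have -> : phi x * (1 - n x * (t - x))
    = phi x + - n x * phi x * (t - x) by ring.
  apply => y /[dup] yI.
  rewrite -in_oitv => /Hs[_ _ S0].
  by rewrite mulNr oppr_le0 mulr_ge0 ?divr_ge0 // ltW.
exists d1, n; split=> // x t xI tI.
have lpos u : I.1 < u < I.2 -> 0 < 1 - n x * (u - x).
  move=> uI; rewrite -(pmulr_rgt0 _ (phi_gt0 x)).
  exact: lt_le_trans (phi_gt0 u) (tangent _ _ xI uI).
split; first exact: lpos.
(* G = s - (M - s x), with derivative s' - M' >= 0 since s' = phi ^- 2 and M' is
   the inverse square of the tangent line of phi at x. *)
pose G u := s u - d1 x * (u - x) / (1 - n x * (u - x)).
have DG u : I.1 < u < I.2 ->
    is_derive u 1 G (d1 u - d1 x / (1 - n x * (u - x)) ^+ 2).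
  move=> uI; apply: is_deriveB; first exact: D0.
  by apply: derive_shift_div; rewrite lt0r_neq0 // lpos.
have DG_ge0 u : I.1 < u < I.2 -> 0 <= d1 u - d1 x / (1 - n x * (u - x)) ^+ 2.
  move=> uI; rewrite subr_ge0.
  have d1u := d1_gt0 _ uI; have d1x := d1_gt0 _ xI.
  rewrite -[d1 x]invrK -invfM -phi2 // -exprMn.
  rewrite -[leRHS]invrK -phi2 // lef_pV2 ?posrE ?exprn_gt0 ?mulr_gt0 ?lpos //.
  by rewrite ler_sqr ?nnegrE ?tangent // ltW // mulr_gt0 ?lpos.
have Gx : G x = s x by rewrite /G subrr mulr0 mul0r subr0.
have l0 := lpos _ tI.
have E : (s t - s x) * (1 - n x * (t - x)) - d1 x * (t - x)
    = (G t - G x) * (1 - n x * (t - x)).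
  by rewrite Gx /G; field; rewrite lt0r_neq0.
rewrite E mulrA mulr_ge0 ?(ltW l0) //.
have [xt|/ltW tx] := leP x t.
  by rewrite mulr_ge0 // subr_ge0 // (ge0_derive_le DG DG_ge0).
by rewrite mulr_le0 // subr_le0 // (ge0_derive_le DG DG_ge0).
Qed.

(** * Order-preserving homeomorphisms and endpoints *)

Lemma oh_mem (R : realType) (I J : R * R) (s : R -> R) (x : R) :
  order_homeo I J s -> I.1 < x < I.2 -> J.1 < s x < J.2.
Proof.
move=> [[fs _ _] _ _ _]; rewrite -!in_oitv !inE; exact: fs.
Qed.

Lemma oh_nonempty (R : realType) (I J : R * R) (s : R -> R) :
  order_homeo I J s -> I.1 < I.2 -> J.1 < J.2.
Proof.
move=> hs I12; have mid : I.1 < (I.1 + I.2) / 2 < I.2.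
  by apply/andP; split; lra.
by have /andP[] := oh_mem hs mid; exact: lt_trans.
Qed.

Lemma oh_lt (R : realType) (I J : R * R) (s : R -> R) (x y : R) :
  order_homeo I J s -> I.1 < x < I.2 -> I.1 < y < I.2 -> x < y -> s x < s y.
Proof. by move=> hs xI yI; apply: (oh_incr hs); rewrite in_oitv. Qed.

Lemma oh_surj (R : realType) (I J : R * R) (s : R -> R) (y : R) :
  order_homeo I J s -> J.1 < y < J.2 -> exists2 x, I.1 < x < I.2 & s x = y.
Proof.
move=> [[_ _ ss] _ _ _]; rewrite -in_oitv inE => /ss[x xI <-].
by exists x => //; rewrite -in_oitv inE.
Qed.

Lemma oh_cvg_left (R : realType) (I J : R * R) (s : R -> R) :
  order_homeo I J s -> I.1 < I.2 -> s t @[t --> I.2^'-] --> J.2.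
Proof.
move=> hs I12; have J12 := oh_nonempty hs I12.
apply/cvgrPdist_lt => e e0.
pose y := Num.max ((J.1 + J.2) / 2) (J.2 - e / 2).
have yJ : J.1 < y < J.2 by rewrite /y lt_max gt_max; apply/andP; split; lra.
have [x0 x0I sx0] := oh_surj hs yJ.
have /andP[ax0 x0b] := x0I.
near=> t.
have x0t : x0 < t by near: t; exact: nbhs_left_gt.
have tI : I.1 < t < I.2.
  by rewrite (lt_trans ax0 x0t); near: t; exact: nbhs_left_lt.
have := oh_lt hs x0I tI x0t.
have /andP[_ st] := oh_mem hs tI.
rewrite sx0 /y gt_max gtr0_norm ?subr_gt0 // => /andP[_]; lra.
Unshelve. all: by end_near. Qed.

Lemma oh_cvg_right (R : realType) (I J : R * R) (s : R -> R) :
  order_homeo I J s -> I.1 < I.2 -> s t @[t --> I.1^'+] --> J.1.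
Proof.
move=> hs I12; have J12 := oh_nonempty hs I12.
apply/cvgrPdist_lt => e e0.
pose y := Num.min ((J.1 + J.2) / 2) (J.1 + e / 2).
have yJ : J.1 < y < J.2 by rewrite /y lt_min gt_min; apply/andP; split; lra.
have [x0 x0I sx0] := oh_surj hs yJ.
have /andP[ax0 x0b] := x0I.
near=> t.
have tx0 : t < x0 by near: t; exact: nbhs_right_lt.
have tI : I.1 < t < I.2.
  by rewrite (lt_trans tx0 x0b) andbT; near: t; exact: nbhs_right_gt.
have := oh_lt hs tI x0I tx0.
have /andP[st _] := oh_mem hs tI.
rewrite sx0 /y lt_min ltr0_norm ?subr_lt0 // => /andP[_]; lra.
Unshelve. all: by end_near. Qed.

(** Both kinds of maps are controlled by relations that are affine in t and in
    s t separately; these pass to the endpoints, where s need not be defined by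
    its formula nor be continuous, by replacing (t, s t) by the pair of
    endpoints of the two intervals. *)
Lemma bilinear_ge0_lim (R : realType) (F : set_system R) {FF : ProperFilter F}
    (s : R -> R) (l k p q r c : R) :
  t @[t --> F] --> l -> s t @[t --> F] --> k ->
  (\near F, 0 <= p + q * F + r * s F + c * (F * s F)) ->
  0 <= p + q * l + r * k + c * (l * k).
Proof.
move=> Fl Fk; apply: cvgr_to_ge.
apply: cvgD; last by apply: cvgMr; apply: cvgM.
apply: cvgD; last exact: cvgMr.
by apply: cvgD; [exact: cvg_cst | exact: cvgMr].
Qed.

Lemma oh_bilinear_left (R : realType) (I J : R * R) (s : R -> R)
    (x p q r c : R) :
  order_homeo I J s -> I.1 < x < I.2 ->
  (forall t, x < t < I.2 -> 0 <= p + q * t + r * s t + c * (t * s t)) ->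
  0 <= p + q * I.2 + r * J.2 + c * (I.2 * J.2).
Proof.
move=> hs /andP[ax xb] H.
apply: (@bilinear_ge0_lim _ (I.2^'-) _ s).
- by apply: cvg_at_left_filter; exact: cvg_id.
- exact: oh_cvg_left hs (lt_trans ax xb).
- near=> t; apply: H; apply/andP; split; near: t.
    exact: nbhs_left_gt.
  exact: nbhs_left_lt.
Unshelve. all: by end_near. Qed.

Lemma oh_bilinear_right (R : realType) (I J : R * R) (s : R -> R)
    (x p q r c : R) :
  order_homeo I J s -> I.1 < x < I.2 ->
  (forall t, I.1 < t < x -> 0 <= p + q * t + r * s t + c * (t * s t)) ->
  0 <= p + q * I.1 + r * J.1 + c * (I.1 * J.1).
Proof.
move=> hs /andP[ax xb] H.
apply: (@bilinear_ge0_lim _ (I.1^'+) _ s).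
- by apply: cvg_at_right_filter; exact: cvg_id.
- exact: oh_cvg_right hs (lt_trans ax xb).
- near=> t; apply: H; apply/andP; split; near: t.
    exact: nbhs_right_gt.
  exact: nbhs_right_lt.
Unshelve. all: by end_near. Qed.

(** * The projective coordinate *)

Lemma proj_coordE (R : realType) (I : R * R) (x : R) : I.1 < x < I.2 ->
  proj_coord I x = ln (x - I.1) - ln (I.2 - x).
Proof.
move=> /andP[ax xb]; rewrite /proj_coord /Cr.
have -> : ((I.1 + I.2) / 2 - I.1) * (I.2 - x)
    / ((x - I.1) * (I.2 - (I.1 + I.2) / 2)) = (I.2 - x) / (x - I.1).
  by field; do ?[apply/andP; split]; rewrite lt0r_neq0 //; lra.
by rewrite ln_div ?posrE ?subr_gt0 // opprB.
Qed.

Lemma proj_coord_lt (R : realType) (I : R * R) (x y : R) :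
  I.1 < x < I.2 -> I.1 < y < I.2 -> x < y -> proj_coord I x < proj_coord I y.
Proof.
move=> xI yI xy; rewrite !proj_coordE //.
case/andP: xI => ax xb; case/andP: yI => ay yb.
by apply: ltrB; rewrite ltr_ln ?posrE ?subr_gt0 // ?ltrD2r // ltrD2l ltrN2.
Qed.

Lemma proj_coord_bij (R : realType) (I : R * R) : I.1 < I.2 ->
  set_bij (oitv I) setT (proj_coord I).
Proof.
move=> I12; split=> // [x y xI yI|u _].
  rewrite !in_oitv in xI yI => E.
  have [xy|yx|//] := ltgtP x y.
    by have := proj_coord_lt xI yI xy; rewrite E ltxx.
  by have := proj_coord_lt yI xI yx; rewrite E ltxx.
have e0 := expR_gt0 u.
(* The solution of (x - I.1) / (I.2 - x) = expR u. *)
pose x := (I.1 + I.2 * expR u) / (1 + expR u).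
have nz : 1 + expR u != 0 by rewrite lt0r_neq0 // addr_gt0.
have E1 : x - I.1 = (I.2 - I.1) / (1 + expR u) * expR u.
  by rewrite /x; field.
have E2 : I.2 - x = (I.2 - I.1) / (1 + expR u) by rewrite /x; field.
have q0 : 0 < (I.2 - I.1) / (1 + expR u).
  by rewrite divr_gt0 ?subr_gt0 // addr_gt0.
have xI : I.1 < x < I.2.
  by rewrite -subr_gt0 -(subr_gt0 x) E1 E2 mulr_gt0 // q0.
exists x; first by rewrite /oitv /= in_itv.
rewrite proj_coordE // E1 E2 lnM ?posrE // expRK; ring.
Qed.

Lemma proj_coordK (R : realType) (I : R * R) (x : R) : I.1 < x < I.2 ->
  pinv (oitv I) (proj_coord I) (proj_coord I x) = x.
Proof.
move=> xI; have I12 : I.1 < I.2 by case/andP: xI; exact: lt_trans.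
by have [_ inj _] := proj_coord_bij I12; rewrite pinvKV // in_oitv.
Qed.

Lemma pinv_coord_mem (R : realType) (I : R * R) (u : R) : I.1 < I.2 ->
  I.1 < pinv (oitv I) (proj_coord I) u < I.2.
Proof.
move=> /proj_coord_bij bI.
have [f _ _] := @bijpinv_bij _ _ (fun=> point) _ _ _ bI.
by rewrite -in_oitv inE; exact: f.
Qed.

Lemma pinv_coordK (R : realType) (I : R * R) (u : R) : I.1 < I.2 ->
  proj_coord I (pinv (oitv I) (proj_coord I) u) = u.
Proof.
move=> I12; have [_ _ sj] := proj_coord_bij I12.
by rewrite (surjpK _ sj) ?inE.
Qed.

(** * Contraction and invariance of the projective metric *)

(** The function P_I - P_J \o s has derivative
    1/(z - I.1) + 1/(I.2 - z) - s' z/(s z - J.1) - s' z/(J.2 - s z).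
    The limits of [schwarzian_chord] at the endpoints give
    s' z/(J.2 - s z) <= 1/(I.2 - z) - n z and
    s' z/(s z - J.1) <= 1/(z - I.1) + n z, and the two n z cancel. *)
Lemma coord_contraction (R : realType) (I J : R * R) (s : R -> R) (x y : R) :
  order_homeo I J s -> nonneg_schwarzian I s ->
  I.1 < x < I.2 -> I.1 < y < I.2 -> x <= y ->
  proj_coord J (s y) - proj_coord J (s x) <= proj_coord I y - proj_coord I x.
Proof.
move=> hs /(schwarzian_chord (oh_incr hs))[ds [n [Ds ds0 Hn]]].
pose Q z := (ln (z - I.1) - ln (I.2 - z)) - (ln (s z - J.1) - ln (J.2 - s z)).
pose dQ z := ((z - I.1)^-1 + (I.2 - z)^-1)
  - (ds z / (s z - J.1) + ds z / (J.2 - s z)).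
have DQ z : I.1 < z < I.2 -> is_derive z 1 Q (dQ z).
  move=> zI; have /andP[az zb] := zI.
  have /andP[asz szb] := oh_mem hs zI.
  have Dsz := Ds _ zI.
  have A1 : is_derive z 1 (fun z => z - I.1) 1.
    by apply: is_derive_eq; rewrite /GRing.scale /=; ring.
  have A2 : is_derive z 1 (fun z => I.2 - z) (-1).
    by apply: is_derive_eq; rewrite /GRing.scale /=; ring.
  have A3 : is_derive z 1 (fun z => s z - J.1) (ds z).
    by apply: is_derive_eq; rewrite /GRing.scale /=; ring.
  have A4 : is_derive z 1 (fun z => J.2 - s z) (- ds z).
    by apply: is_derive_eq; rewrite /GRing.scale /=; ring.
  have B (f : R -> R) d : 0 < f z -> is_derive z 1 f d ->
      is_derive z 1 (fun z => ln (f z)) (d / f z).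
    move=> f0 Df; rewrite mulrC.
    exact: (is_derive1_comp (is_derive1_ln f0) Df).
  have C1 := B (fun z => z - I.1) _ _ A1.
  have C2 := B (fun z => I.2 - z) _ _ A2.
  have C3 := B (fun z => s z - J.1) _ _ A3.
  have C4 := B (fun z => J.2 - s z) _ _ A4.
  have := is_deriveB (is_deriveB (C1 _) (C2 _)) (is_deriveB (C3 _) (C4 _)).
  rewrite !subr_gt0 => /(_ az zb asz szb) D.
  apply: (@is_derive_eq _ _ _ _ _ _ _ _ D); rewrite /dQ.
  ring.
have dQ0 z : I.1 < z < I.2 -> 0 <= dQ z.
  move=> zI; have /andP[az zb] := zI.
  have /andP[asz szb] := oh_mem hs zI.
  have L : 0 <= (J.2 - s z) * (1 - n z * (I.2 - z)) - ds z * (I.2 - z).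
    rewrite [leRHS](_ : _ = - s z * (1 + n z * z) + ds z * z
      + (n z * s z - ds z) * I.2 + (1 + n z * z) * J.2 + - n z * (I.2 * J.2));
      last by ring.
    apply: (oh_bilinear_left hs zI) => t /andP[zt tb].
    have tI : I.1 < t < I.2 by rewrite (lt_trans az zt).
    have [_] := Hn _ _ zI tI; rewrite pmulr_rge0 ?subr_gt0 //.
    by congr (_ <= _); ring.
  have L' : 0 <= (s z - J.1) * (1 + n z * (z - I.1)) - ds z * (z - I.1).
    rewrite [leRHS](_ : _ = s z * (1 + n z * z) - ds z * z
      + (- n z * s z + ds z) * I.1 + - (1 + n z * z) * J.1
      + n z * (I.1 * J.1)); last by ring.
    apply: (oh_bilinear_right hs zI) => t /andP[at_ tz].
    have tI : I.1 < t < I.2 by rewrite at_ (lt_trans tz zb).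
    have [_] := Hn _ _ zI tI; rewrite nmulr_rge0 ?subr_lt0 // -oppr_ge0.
    by congr (_ <= _); ring.
  have -> : dQ z =
      ((J.2 - s z) * (1 - n z * (I.2 - z)) - ds z * (I.2 - z))
        / ((J.2 - s z) * (I.2 - z))
      + ((s z - J.1) * (1 + n z * (z - I.1)) - ds z * (z - I.1))
        / ((s z - J.1) * (z - I.1)).
    by rewrite /dQ; field; rewrite !lt0r_neq0 ?subr_gt0.
  by rewrite addr_ge0 // divr_ge0 // mulr_ge0 // ltW // subr_gt0.
move=> xI yI xy.
have := ge0_derive_le DQ dQ0 xI yI xy.
rewrite !(proj_coordE (I := I)) // !(proj_coordE (I := J)) ?(oh_mem hs) //.
rewrite /Q; lra.
Qed.

(** The homeomorphism sends endpoints to endpoints only in the limit, and the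
    formula of h might a priori have its pole at an endpoint.  Hence the
    identity for three interior points x, y, t is written without denominators
    in t before t tends to either endpoint. *)
Lemma lf_cross_ratio (R : realType) (I J : R * R) (h : R -> R) (x y : R) :
  order_homeo I J h -> linear_fractional I h ->
  I.1 < x < I.2 -> I.1 < y < I.2 ->
  (h x - J.1) * (y - I.1) * ((J.2 - h y) * (I.2 - x))
  = (h y - J.1) * (x - I.1) * ((J.2 - h x) * (I.2 - y)).
Proof.
move=> hh [A [B [C [D [_ hE]]]]] xI yI.
have key z : I.1 < z < I.2 -> C * z + D != 0 /\ h z = (A * z + B) / (C * z + D).
  by rewrite -in_oitv; exact: hE.
have [nx Ex] := key _ xI; have [ny Ey] := key _ yI.
have E t : I.1 < t < I.2 ->
    (h x - h t) * (y - t) * (C * x + D) = (h y - h t) * (x - t) * (C * y + D).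
  by move=> /key[nt Et]; rewrite Ex Ey Et; field; rewrite nx ny nt.
(* The coefficients of E as a polynomial in t and h t. *)
pose a0 := h x * y * (C * x + D) - h y * x * (C * y + D).
pose a1 := h y * (C * y + D) - h x * (C * x + D).
pose a2 := x * (C * y + D) - y * (C * x + D).
pose a3 := C * x - C * y.
have E0 t : I.1 < t < I.2 -> a0 + a1 * t + a2 * h t + a3 * (t * h t) = 0.
  move=> /E /eqP; rewrite -subr_eq0 => /eqP <-; rewrite /a0 /a1 /a2 /a3; ring.
have E2 : a0 + a1 * I.2 + a2 * J.2 + a3 * (I.2 * J.2) = 0.
  apply/eqP; rewrite eq_le; apply/andP; split.
    rewrite -oppr_ge0 !opprD -!mulNr.
    apply: (oh_bilinear_left hh xI) => t /andP[xt tb].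
    rewrite !mulNr -!opprD E0 ?oppr0 // tb andbT (lt_trans _ xt) //.
    by case/andP: xI.
  apply: (oh_bilinear_left hh xI) => t /andP[xt tb].
  by rewrite E0 // tb andbT (lt_trans _ xt) //; case/andP: xI.
have E1 : a0 + a1 * I.1 + a2 * J.1 + a3 * (I.1 * J.1) = 0.
  apply/eqP; rewrite eq_le; apply/andP; split.
    rewrite -oppr_ge0 !opprD -!mulNr.
    apply: (oh_bilinear_right hh xI) => t /andP[at_ tx].
    by rewrite !mulNr -!opprD E0 ?oppr0 // at_ (lt_trans tx) //; case/andP: xI.
  apply: (oh_bilinear_right hh xI) => t /andP[at_ tx].
  by rewrite E0 // at_ (lt_trans tx) //; case/andP: xI.
have F1 : (h x - J.1) * (y - I.1) * (C * x + D)
    = (h y - J.1) * (x - I.1) * (C * y + D).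
  by apply/eqP; rewrite -subr_eq0 -E1 /a0 /a1 /a2 /a3; apply/eqP; ring.
have F2 : (J.2 - h x) * (I.2 - y) * (C * x + D)
    = (J.2 - h y) * (I.2 - x) * (C * y + D).
  by apply/eqP; rewrite -subr_eq0 -E2 /a0 /a1 /a2 /a3; apply/eqP; ring.
apply: (mulIf (mulf_neq0 nx ny)).
transitivity ((h x - J.1) * (y - I.1) * (C * x + D)
  * ((J.2 - h y) * (I.2 - x) * (C * y + D))); first by ring.
by rewrite F1 -F2; ring.
Qed.

Lemma coord_translation (R : realType) (I J : R * R) (h : R -> R) (x y : R) :
  order_homeo I J h -> linear_fractional I h ->
  I.1 < x < I.2 -> I.1 < y < I.2 ->
  proj_coord J (h x) - proj_coord I x = proj_coord J (h y) - proj_coord I y.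
Proof.
move=> hh hl xI yI; have := lf_cross_ratio hh hl xI yI.
have hxJ := oh_mem hh xI; have hyJ := oh_mem hh yI.
rewrite !(proj_coordE (I := I)) // !(proj_coordE (I := J)) //.
case/andP: xI => ax xb; case/andP: yI => ay yb.
case/andP: hxJ => ahx hxb; case/andP: hyJ => ahy hyb.
move=> /(congr1 (@ln R)).
rewrite !lnM ?posrE ?mulr_gt0 ?subr_gt0 //; lra.
Qed.

(** * Maps in projective coordinates *)

Lemma proj_map_id (R : realType) (I : R * R) (u : R) : I.1 < I.2 ->
  proj_map I I id u = u.
Proof. exact: pinv_coordK. Qed.

Lemma eq_proj_map (R : realType) (I J : R * R) (f g : R -> R) (u : R) :
  I.1 < I.2 -> {in oitv I, f =1 g} -> proj_map I J f u = proj_map I J g u.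
Proof.
by move=> I12 fg; rewrite /proj_map /= fg // in_oitv pinv_coord_mem.
Qed.

Lemma proj_map_comp (R : realType) (I J K : R * R) (f g : R -> R) (u : R) :
  I.1 < I.2 -> (forall x, I.1 < x < I.2 -> J.1 < f x < J.2) ->
  proj_map I K (g \o f) u = proj_map J K g (proj_map I J f u).
Proof.
by move=> I12 fIJ; rewrite /proj_map /= proj_coordK // fIJ // pinv_coord_mem.
Qed.

Lemma proj_map_nonneg_schwarzian (R : realType) (I J : R * R) (s : R -> R)
    (u v : R) :
  I.1 < I.2 -> order_homeo I J s -> nonneg_schwarzian I s -> u <= v ->
  0 <= proj_map I J s v - proj_map I J s u <= v - u.
Proof.
move=> I12 hs Ss uv.
have xI := pinv_coord_mem u I12; have yI := pinv_coord_mem v I12.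
rewrite /proj_map /= -{3}(pinv_coordK u I12) -{3}(pinv_coordK v I12).
set x := pinv _ _ u in xI *; set y := pinv _ _ v in yI *.
have xy : x <= y.
  rewrite leNgt; apply/negP => /(proj_coord_lt yI xI).
  by rewrite /x /y !pinv_coordK // ltNge uv.
rewrite coord_contraction // andbT subr_ge0.
move: xy; rewrite le_eqVlt => /predU1P[->//|/(oh_lt hs xI yI) sxy].
by rewrite ltW // proj_coord_lt // (oh_mem hs).
Qed.

Lemma proj_map_linear_fractional (R : realType) (I J : R * R) (h : R -> R)
    (u v : R) :
  I.1 < I.2 -> order_homeo I J h -> linear_fractional I h ->
  proj_map I J h u - u = proj_map I J h v - v.
Proof.
move=> I12 hh hl; have xI := pinv_coord_mem u I12.
have := coord_translation hh hl xI (pinv_coord_mem v I12).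
by rewrite !pinv_coordK.
Qed.

(** * Compositions of contractions and almost translations *)

(** Since F i is nondecreasing and 1-Lipschitz, F i w - F i v lies between 0 and
    w - v.  The partial sum of the c i is within D of 0, and by induction within D
    plus the errors of w - v; hence it is that close to u i - v i too. *)
Lemma perturbed_contractions (R : realDomainType) (m : nat) (F : nat -> R -> R)
    (c e u v : nat -> R) (D : R) :
  (forall i x y, (1 <= i <= m)%N -> x <= y -> 0 <= F i y - F i x <= y - x) ->
  (forall i, (1 <= i <= m)%N ->
    exists2 w, u i = F i w & `|w - (u i.-1 + c i)| <= e i) ->
  (forall i, (1 <= i <= m)%N -> v i = F i (v i.-1)) ->
  u 0%N = v 0%N -> 0 <= D ->
  (forall j, (1 <= j <= m)%N -> `|\sum_(1 <= i < j.+1) c i| <= D) ->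
  `|u m - v m| <= \sum_(1 <= i < m.+1) e i + 2 * D.
Proof.
move=> HF Hu Hv uv0 D0 HD.
have E0 j : (j <= m)%N -> 0 <= \sum_(1 <= i < j.+1) e i.
  move=> jm; rewrite big_nat_cond; apply: sumr_ge0 => i /andP[/andP[i1 ij] _].
  have [|w _] := Hu i; first by rewrite i1 (leq_trans _ jm).
  exact: le_trans.
have inv j : (j <= m)%N ->
    `|u j - v j - \sum_(1 <= i < j.+1) c i| <= D + \sum_(1 <= i < j.+1) e i.
  elim: j => [_|j IH jm].
    by rewrite uv0 !big_geq // subrr subr0 normr0 addr0.
  have jm1 : (1 <= j.+1 <= m)%N by [].
  have := E0 _ (ltnW jm); have := IH (ltnW jm); have := HD _ jm1.
  have [w -> /=] := Hu _ jm1; rewrite (Hv j.+1) //=.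
  rewrite ![\sum_(1 <= i < j.+2) _]big_nat_recr //=.
  set S := \sum_(1 <= i < j.+1) c i; set E := \sum_(1 <= i < j.+1) e i.
  rewrite !ler_norml => /andP[w1 w2] /andP[s1 s2] /andP[i1 i2] eE.
  have [vw|/ltW wv] := leP (v j) w.
    by have /andP[f1 f2] := HF _ _ _ jm1 vw; apply/andP; split; lra.
  by have /andP[f1 f2] := HF _ _ _ jm1 wv; apply/andP; split; lra.
case: m => [|m] in HF Hu Hv HD E0 inv *.
  by rewrite uv0 subrr normr0 big_geq // add0r mulr_ge0.
have := E0 _ (leqnn _); have := inv _ (leqnn _); have := HD m.+1 (leqnn _).
rewrite !ler_norml => /andP[? ?] /andP[? ?] ?; apply/andP; split; lra.
Qed.

(** * The main estimate *)

Lemma C0norm_ge (R : realType) (f : R -> R) (x : R) : (`|f x|%:E <= C0norm f)%E.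
Proof. by apply: ereal_sup_ubound; exists x. Qed.


Lemma comp_upto_mem (R : realType) (m : nat) (U : nat -> R * R)
    (F : nat -> R -> R) (x : R) :
  (forall i z, (1 <= i <= m)%N -> (U i.-1).1 < z < (U i.-1).2 ->
    (U i).1 < F i z < (U i).2) ->
  (U 0%N).1 < x < (U 0%N).2 ->
  forall j, (j <= m)%N -> (U j).1 < comp_upto F j x < (U j).2.
Proof.
move=> HF x0; elim=> [//|j IH jm] /=.
by apply: (HF j.+1) => //; exact: IH (ltnW jm).
Qed.

Theorem mainTheorem2 (R : realType) (m : nat) (a b : R) (f : R -> R)
    (U V W : nat -> R * R) (H sigma g h : nat -> R -> R)
    (hf : standard_composition m a b f U V H sigma)
    (hg : forall i, (1 <= i <= m)%N -> order_homeo (U i.-1) (W i) (g i))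
    (hh : forall i, (1 <= i <= m)%N -> order_homeo (W i) (V i) (h i))
    (hlf : forall i, (1 <= i <= m)%N -> linear_fractional (W i) (h i))
    (hH : forall i, (1 <= i <= m)%N ->
       {in oitv (U i.-1), H i =1 h i \o g i}) :
  (C0norm (fun x => (proj_map (U 0%N) (U m) f x - sigma_comp m V U sigma x)%R)
     <= Dtilde m U W g + 2%:E * Delta m W V h)%E.
Proof.
case: hf => m0 ab U0 HH Hs HS _ Hf.
have nU j : (j <= m)%N -> (U j).1 < (U j).2.
  elim: j => [_|j IH jm]; first by rewrite U0.
  have jm1 : (1 <= j.+1 <= m)%N by [].
  exact: oh_nonempty (Hs _ jm1) (oh_nonempty (HH _ jm1) (IH (ltnW jm))).
have nU' i : (1 <= i <= m)%N -> (U i.-1).1 < (U i.-1).2.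
  by case: i => // i /ltnW; exact: nU.
have nW i (im : (1 <= i <= m)%N) := oh_nonempty (hg i im) (nU' i im).
have nV i (im : (1 <= i <= m)%N) := oh_nonempty (hh i im) (nW i im).
(* The constant value of P(h_i) - id, read off at 0. *)
pose c i := proj_map (W i) (V i) (h i) 0 - 0.
have cE i u : (1 <= i <= m)%N -> proj_map (W i) (V i) (h i) u = u + c i.
  move=> im; rewrite /c (proj_map_linear_fractional 0 u) ?nW //; try exact: hlf.
    by rewrite addrC subrK.
  exact: hh.
have HD j : (1 <= j <= m)%N ->
    (`|\sum_(1 <= i < j.+1) c i|%:E <= Delta m W V h)%E.
  move=> jm; apply: (@bigmax_sup_seq _ _ _ _ _ j) => //.
    by rewrite mem_index_iota ltnS.
  exact: (C0norm_ge
    (fun x => \sum_(1 <= i < j.+1) (proj_map (W i) (V i) (h i) x - x)) 0).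
have dg0 j : (0 <= dist_id (U j.-1) (W j) (g j))%E.
  by apply: le_trans (C0norm_ge _ 0); rewrite lee_fin.
have Dt0 : (0 <= Dtilde m U W g)%E by apply: sume_ge0.
(* An infinite Delta makes the bound trivial; otherwise it is a real number. *)
case: (Delta m W V h) HD => [D|_|HD]; last first.
- by have := HD 1%N m0; rewrite leeNy_eq.
- by rewrite gt0_muley ?lte_fin // addey ?leey // gt_eqF // (lt_le_trans _ Dt0).
move=> HD; have {}HD j : (1 <= j <= m)%N -> `|\sum_(1 <= i < j.+1) c i| <= D.
  by move=> /HD; rewrite lee_fin.
apply: ge_ereal_sup => _ [x _ <-].
pose F i := sigma i \o H i.
pose u j := proj_map (U 0%N) (U j) (comp_upto F j) x.
pose v j := comp_upto (fun i => proj_map (V i) (U i) (sigma i)) j x.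
pose w i := proj_map (U i.-1) (W i) (g i) (u i.-1).
(* The error of P(g_i) is measured only along the orbit of x, hence it is a real
   number even where the C^0 norm is infinite. *)
pose e i := `|w i - u i.-1|.
have Hu i : (1 <= i <= m)%N ->
    u i = proj_map (V i) (U i) (sigma i) (w i + c i).
  move=> im; rewrite -cE // /w -(proj_map_comp (J := W i)) ?nU' //; last first.
    by move=> z; exact: oh_mem (hg _ im).
  rewrite -(eq_proj_map _ _ (nU' _ im) (hH _ im)).
  rewrite -proj_map_comp ?nU' //; last by move=> z; exact: oh_mem (HH _ im).
  case: i im => // i im; rewrite /u /= -proj_map_comp //; first exact: nU.
  move=> z zU; apply: (@comp_upto_mem _ m) => //.
    by move=> k y km yU; apply: oh_mem (Hs _ km) (oh_mem (HH _ km) yU).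
  by case/andP: im => _ /ltnW.
have := @perturbed_contractions _ m
  (fun i => proj_map (V i) (U i) (sigma i)) c e u v D.
have -> : proj_map (U 0%N) (U m) f x = u m.
  by apply: eq_proj_map; [exact: nU | rewrite U0].
move=> /(_ _ _ _ _ _ HD) B.
apply: (@le_trans _ _ (\sum_(1 <= i < m.+1) e i + 2 * D)%:E).
  rewrite lee_fin; apply: B.
  - move=> i y z im yz; apply: proj_map_nonneg_schwarzian => //.
    + exact: nV.
    + exact: Hs.
    + exact: HS.
  - move=> i im; exists (w i + c i); first exact: Hu.
    by rewrite /e opprD addrACA subrr addr0.
  - by case.
  - by rewrite /u /v /= proj_map_id // nU.
  - exact: le_trans (HD 1%N m0).
rewrite EFinD EFinM leeD2r // -sumEFin.
apply: lee_sum => i _; exact: C0norm_ge (u i.-1).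
Qed.
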